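(* For each $n\ge 1$, consider $F$ as a permutation of $\mathcal{C}_n$. Then: (i) all $F$-orbits (cycles) on $\mathcal{C}_n$ have the same length, and this length is a power of $2$; (ii) all $F$-orbits on $\mathcal{C}_n$ have the same parity; (iii) the common length is $1$ for $n=1$ and is $2^{k}$ for $n\ge 2$, where $k$ is the number of binary digits of $n-2$ (so $k=0$ for $n=2$); the common parity is $1$ if $n=1$ or $n=2^{j}+1$ for some integer $j\ge 1$, and is $0$ for all other $n\ge 2$.
   Context: Dyck paths are words in $U$ (upstep) and $D$ (downstep) with equally many of each such that every prefix has at least as many $U$'s as $D$'s; size = number of $U$'s; $\epsilon$ = empty path; powers denote repetition. A nonempty Dyck path is primitive if no nonempty proper prefix is a Dyck path; every nonempty Dyck path is uniquely a concatenation of primitive ones (its components). The bijection $F$ on Dyck paths: $F(\epsilon)=\epsilon$; if $P$ has components $P_1,\dots,P_r$, $r\ge2$, then $F(P)=F(P_1)\cdots F(P_r)$; a primitive $P$ is uniquely $P=UQ(UD)^iD$ with $i\ge0$ and $Q$ a Dyck path that is empty or ends with $DD$, and $F(P)=U^{i+1}F(R)UDD^{i+1}$ if $Q$ is primitive, $Q=URD$, while $F(P)=U^{i+1}F(Q)D^{i+1}$ if $Q$ is not primitive (including $Q=\epsilon$). The height of a vertex is its height above the starting level; the height of a path is the maximum vertex height. A Dyck path avoids $DUU$ if it has no three consecutive steps $D,U,U$. To a $DUU$-avoiding Dyck $n$-path of height $h$ associate the composition $(c_1,\dots,c_h)$ of $n$ where $c_i$ is the number of downsteps ending at height $h-i$;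 this is a bijection between $DUU$-avoiding Dyck $n$-paths and compositions of $n$, and primitive such paths correspond to compositions whose last entry is $1$. $F$ maps primitive $DUU$-avoiding Dyck $n$-paths to primitive $DUU$-avoiding Dyck $n$-paths, hence induces a permutation, also denoted $F$, of the set $\mathcal{C}_n$ of compositions of $n$ with last entry $1$. The parity of a composition is the parity of its number of entries (1 if odd, 0 if even), and the parity of an $F$-orbit is the sum mod $2$ of the parities of the compositions in it. *)

(* Defs.v *)
(* A path is a word of booleans: [true] is the upstep, [false] the downstep. *)
From HB Require Import structures.
From mathcomp Require Import all_boot all_fingroup zify.

Set Implicit Arguments.
Unset Strict Implicit.
Unset Printing Implicit Defensive.

Local Notation U := true.
Local Notation D := false.

Definition word := seq bool.

Definition dyck (w : word) : bool :=
  (count_mem U w == count_mem D w)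
  && all (fun i => count_mem D (take i w) <= count_mem U (take i w))
         (iota 0 (size w).+1).

Definition path_size (w : word) : nat := count_mem U w.

Definition primitive (w : word) : bool :=
  [&& w != [::], dyck w
    & all (fun i => ~~ dyck (take i w)) (iota 1 (size w).-1)].

Definition avoids_DUU (w : word) : bool := ~~ infix [:: D; U; U] w.

(* [(UD)^i] *)
Definition ud (i : nat) : word := flatten (nseq i [:: U; D]).

(* Number of steps of the first component of a nonempty Dyck path. *)
Definition first_return (w : word) : nat :=
  (find (fun i => dyck (take i w)) (iota 1 (size w))).+1.

(* Applied to the reversal of a word: removes the maximal trailing [(UD)^i] of
   that word and returns [i]. *)
Fixpoint strip_ud (s : word) : word * nat :=
  if s is D :: U :: s' then let: (q, i) := strip_ud s' in (q, i.+1)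
  else (s, 0).

(* The word between the first and the last letter. *)
Definition inner (w : word) : word := take (size w).-2 (behead w).

(* [m] is fuel; [dyckF_fuel] shows that the size of the word suffices, and
   [dyckF_nil], [dyckF_components], [dyckF_prim_prim], [dyckF_prim_nonprim]
   are the recursive clauses for [F]. *)
Fixpoint dyckF_rec (m : nat) (w : word) : word :=
  if m is m'.+1 then
    if w == [::] then [::] else
    let k := first_return w in
    if k < size w then dyckF_rec m' (take k w) ++ dyckF_rec m' (drop k w)
    else
      let: (s, i) := strip_ud (rev (inner w)) in
      let Q := rev s in
      if primitive Q then
        nseq i.+1 U ++ dyckF_rec m' (inner Q) ++ [:: U; D] ++ nseq i.+1 D
      else nseq i.+1 U ++ dyckF_rec m' Q ++ nseq i.+1 D
  else [::].

Definition dyckF (w : word) : word := dyckF_rec (size w) w.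

(* Heights of the end vertices of the successive steps, from height [g]; the
   truncation of [g.-1] at 0 never matters on a Dyck path. *)
Fixpoint heights (g : nat) (w : word) : seq nat :=
  if w is s :: w' then
    let g' := if s then g.+1 else g.-1 in g' :: heights g' w'
  else [::].

Definition height (w : word) : nat := \max_(g <- heights 0 w) g.

Definition downs_to (w : word) (j : nat) : nat :=
  count (fun p => p == (D, j)) (zip w (heights 0 w)).

Definition comp_of_path (w : word) : seq nat :=
  [seq downs_to w (height w - i) | i <- iota 1 (height w)].

(* [rpath (rev c)] is the unique [DUU]-avoiding Dyck path with composition [c];
   see [path_of_compK] and [dyck_avoids_rpath]. *)
Fixpoint rpath (s : seq nat) : word :=
  if s is k :: s' then U :: rpath s' ++ D :: ud k.-1 else [::].

Definition path_of_comp (c : seq nat) : word := rpath (rev c).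

Definition is_composition (n : nat) (c : seq nat) : bool :=
  all (fun a => 0 < a) c && (sumn c == n).

(* Compositions of [n] with last entry 1. *)
Record comp1 (n : nat) := Comp1 {
  comp1val :> seq nat;
  _ : is_composition n comp1val && (last 0 comp1val == 1) }.

HB.instance Definition _ n := [isSub for @comp1val n].
HB.instance Definition _ n := [Countable of comp1 n by <:].

Definition comp1_enum n : seq (comp1 n) :=
  undup (pmap insub [seq [seq val a | a <- val b] | b <- enum {: n.-bseq 'I_n.+1}]).

Lemma size_composition c : all (fun a => 0 < a) c -> size c <= sumn c.
Proof. by elim: c => //= a c IH /andP[a0 /IH]; lia. Qed.

Lemma comp1_enumP n : Finite.axiom (comp1_enum n).
Proof.
apply: Finite.uniq_enumP; first exact: undup_uniq.
move=> c; rewrite mem_undup mem_pmap_sub /=; apply/mapP.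
case: c => c /= /andP[/andP[cpos /eqP csum] _].
have sc : size [seq inord a : 'I_n.+1 | a <- c] <= n.
  by rewrite size_map -csum size_composition.
exists (Bseq sc); rewrite ?mem_enum //= -map_comp -[LHS]map_id.
apply/eq_in_map => a ac /=; rewrite inordK // ltnS -csum.
by elim: c {cpos csum sc} ac => //= b c IH; rewrite inE => /orP[/eqP->|/IH]; lia.
Qed.

HB.instance Definition _ n := isFinite.Build (comp1 n) (@comp1_enumP n).

(* Dyck words, recursively: from height [h] down to height 0. *)
Fixpoint dk (h : nat) (w : word) : bool :=
  match w with
  | [::] => h == 0
  | U :: w' => dk h.+1 w'
  | D :: w' => if h is h'.+1 then dk h' w' else false
  end.

Lemma all_iotaS (P : pred nat) m :
  all P (iota 0 m.+1) = P 0 && all (fun i => P i.+1) (iota 0 m).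
Proof. by rewrite [iota _ _]/= (iotaDl 1 0 m) /= all_map. Qed.

Lemma dkE h w : dk h w =
  (h + count_mem U w == count_mem D w)
  && all (fun i => count_mem D (take i w) <= h + count_mem U (take i w))
         (iota 0 (size w).+1).
Proof.
elim: w h => [|b w IH] h; first by rewrite /= !addn0 andbT.
rewrite [in RHS]all_iotaS take0 -/(size (b :: w)) [X in X && all _ _]/=.
case: b; last case: h => [|h].
- rewrite [LHS]/= IH; congr (_ && _); first by rewrite /=; lia.
  by apply: eq_all => i /=; lia.
- by rewrite [size _]/= all_iotaS /= take0 /= !andbF.
- by rewrite [LHS]/= IH; congr (_ && _).
Qed.

Lemma dyckE w : dyck w = dk 0 w.
Proof. by rewrite dkE. Qed.

Lemma dk_cat h g u v : dk g u -> dk (g + h) (u ++ v) = dk h v.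
Proof.
elim: u g => [|[] u IH] g /=; first by move/eqP->.
- by move/IH; rewrite addSn.
- by case: g => // g /IH.
Qed.

Lemma dyck_cat u v : dyck u -> dyck (u ++ v) = dyck v.
Proof. by rewrite !dyckE => /dk_cat-/(_ 0). Qed.

Lemma dyck_UD a : dyck a -> dyck (U :: a ++ [:: D]).
Proof. by rewrite !dyckE /= => /dk_cat-/(_ 1)->. Qed.

Lemma dyck_ud i : dyck (ud i).
Proof. by elim: i => // i IH; rewrite /ud /= (@dyck_cat [:: U; D]). Qed.

Lemma prim_UD a : dyck a -> primitive (U :: a ++ [:: D]).
Proof.
move=> da; rewrite /primitive dyck_UD //=; apply/allP => i.
rewrite mem_iota size_cat addn1 /= => /andP[i1 ia].
case: i i1 ia => // i _; rewrite add1n !ltnS => ia.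
rewrite /dyck negb_and; apply/orP; left.
rewrite /= takel_cat // ; move: da; rewrite /dyck => /andP[_ /allP/(_ i)].
by rewrite mem_iota ltnS ia add0n neq_ltn add1n ltnS => ->; rewrite ?orbT.
Qed.

Lemma first_return_prim p v : primitive p -> first_return (p ++ v) = size p.
Proof.
case/and3P=> p0 dp /allP pp; rewrite /first_return size_cat.
have sp : 0 < size p by case: p p0 {dp pp}.
have -> : size p + size v = (size p).-1 + (size v).+1 by lia.
rewrite iotaD find_cat ifN; last first.
  apply/hasPn => i; move=> /[dup] /pp /[swap]; rewrite mem_iota => /andP[_ ip].
  by rewrite takel_cat //; lia.
have -> : 1 + (size p).-1 = size p by lia.
by rewrite /= take_size_cat // dp size_iota; lia.
Qed.

Lemma strip_size s : size (strip_ud s).1 <= size s.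
Proof.
elim: {s}(size s) {-2}s (leqnn (size s)) => [|m IH] [|[] [|[] s]] //= ss.
by have := IH s (ltnW ss); case: strip_ud => q i /=; lia.
Qed.

Lemma size_inner w : size (inner w) <= (size w).-2.
Proof. by rewrite /inner size_take; case: ifP => //; rewrite size_behead; lia. Qed.

Lemma dyckF_recE m s w : dyckF_rec m.+1 (s :: w) =
  (let k := first_return (s :: w) in
    if k < size (s :: w) then
      dyckF_rec m (take k (s :: w)) ++ dyckF_rec m (drop k (s :: w))
    else
      let: (r, i) := strip_ud (rev (inner (s :: w))) in
      if primitive (rev r) then
        nseq i.+1 U ++ dyckF_rec m (inner (rev r)) ++ [:: U; D] ++ nseq i.+1 D
      else nseq i.+1 U ++ dyckF_rec m (rev r) ++ nseq i.+1 D).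
Proof. by []. Qed.

Lemma dyckF_rec_fuel m n w :
  size w <= m -> size w <= n -> dyckF_rec m w = dyckF_rec n w.
Proof.
elim: m n w => [|m IH] [|n] [|s w] // wm wn.
have k0 : 0 < first_return (s :: w) by [].
rewrite !dyckF_recE; move: (first_return _) k0 => k k0; rewrite [size _]/=.
move: wm wn; rewrite ![size _]/= => wm wn.
rewrite [LHS]/= [RHS]/=; case: ifP => kw.
  have st : size (take k (s :: w)) = k.
    by rewrite size_take_min /=; apply/minn_idPl; lia.
  have sd : size (drop k (s :: w)) = (size w).+1 - k by rewrite size_drop.
  by congr (_ ++ _); apply: IH; rewrite ?st ?sd; lia.
case E: strip_ud => [r i].
have rs : size r <= size w.
  have := strip_size (rev (inner (s :: w))); rewrite E size_rev.
  by have := size_inner (s :: w); rewrite /=; lia.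
move: wm wn; rewrite /= => wm wn.
have rI : size (inner (rev r)) <= size w.
  by have := size_inner (rev r); rewrite size_rev; lia.
by rewrite !(IH n) // ?size_rev; lia.
Qed.

Lemma dyckF_fuel m w : size w <= m -> dyckF_rec m w = dyckF w.
Proof. by move=> wm; apply: dyckF_rec_fuel. Qed.

Lemma dyckF_nil : dyckF [::] = [::].
Proof. by []. Qed.

Lemma dyckF_prim_cat p v : primitive p -> dyckF (p ++ v) = dyckF p ++ dyckF v.
Proof.
move=> pp; have sp : 0 < size p by case: p pp.
have fr := first_return_prim v pp.
case: v fr => [|t v]; first by rewrite !cats0.
case: p pp sp => // s p pp _ fr.
rewrite {1}/dyckF cat_cons [size _]/= dyckF_recE -cat_cons; cbv zeta; rewrite fr ifT; last first.
  by rewrite size_cat /=; lia.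
rewrite take_size_cat // drop_size_cat //.
by rewrite !dyckF_fuel //; rewrite size_cat /=; lia.
Qed.

Lemma dyckF_components ps :
  all primitive ps -> dyckF (flatten ps) = flatten [seq dyckF p | p <- ps].
Proof.
by elim: ps => //= p ps IH /andP[pp /IH <-]; rewrite dyckF_prim_cat.
Qed.

Lemma inner_UD a : inner (U :: a ++ [:: D]) = a.
Proof. by rewrite /inner /= size_cat addn1 /= take_size_cat. Qed.

Lemma ud_catC i : rev (ud i) = flatten (nseq i [:: D; U]).
Proof.
elim: i => // i IH; rewrite -{1}addn1 /ud nseqD flatten_cat rev_cat.
by rewrite -/(ud i) IH.
Qed.

Lemma strip_udE Q i : (Q == [::]) || suffix [:: D; D] Q ->
  strip_ud (rev (Q ++ ud i)) = (rev Q, i).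
Proof.
move=> hQ; rewrite rev_cat ud_catC.
have Q0 : strip_ud (rev Q) = (rev Q, 0).
  case/orP: hQ => [/eqP->//|/suffixP[A ->]].
  by rewrite rev_cat.
by elim: i => [|i IH] //=; rewrite IH.
Qed.

Lemma prim_Q_ud i Q : dyck Q -> primitive (U :: Q ++ ud i ++ [:: D]).
Proof. by move=> dQ; rewrite catA prim_UD // dyck_cat ?dyck_ud. Qed.

Lemma dyckF_prim i Q : dyck Q -> (Q == [::]) || suffix [:: D; D] Q ->
  dyckF (U :: Q ++ ud i ++ [:: D]) =
  if primitive Q then
    nseq i.+1 U ++ dyckF (inner Q) ++ [:: U; D] ++ nseq i.+1 D
  else nseq i.+1 U ++ dyckF Q ++ nseq i.+1 D.
Proof.
move=> dQ hQ; have := prim_Q_ud i dQ; set P := U :: _ => pP.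
have fr : first_return P = size P.
  by have := first_return_prim [::] pP; rewrite cats0.
rewrite /dyckF -/P [size P]/= dyckF_recE -/P; cbv zeta; rewrite fr ltnn.
have -> : inner P = Q ++ ud i by rewrite /P catA inner_UD.
rewrite strip_udE // revK.
by case: ifP => _; rewrite dyckF_fuel // ?size_cat; have := size_inner Q; lia.
Qed.

Lemma dyckF_prim_prim i R :
  dyck R -> suffix [:: D; D] (U :: R ++ [:: D]) ->
  dyckF (U :: (U :: R ++ [:: D]) ++ ud i ++ [:: D]) =
  nseq i.+1 U ++ dyckF R ++ [:: U; D] ++ nseq i.+1 D.
Proof.
move=> dR sR; rewrite (dyckF_prim i (dyck_UD dR)); last by rewrite sR orbT.
by rewrite prim_UD // inner_UD.
Qed.

Lemma dyckF_prim_nonprim i Q :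
  dyck Q -> (Q == [::]) || suffix [:: D; D] Q -> ~~ primitive Q ->
  dyckF (U :: Q ++ ud i ++ [:: D]) = nseq i.+1 U ++ dyckF Q ++ nseq i.+1 D.
Proof. by move=> dQ hQ /negbTE nQ; rewrite dyckF_prim // nQ. Qed.

(* Reversed composition of [dyckF (rpath s)]. *)
Fixpoint rF (s : seq nat) : seq nat :=
  match s with
  | k :: k' :: s' =>
    if s' is [::] then k :: nseq k' 1
    else k :: nseq k'.-1 1 ++ (head 0 (rF s')).+1 :: behead (rF s')
  | _ => s
  end.

Lemma seq2_ind (T : Type) (P : seq T -> Prop) :
  P [::] -> (forall x, P [:: x]) -> (forall x y s, P s -> P [:: x, y & s]) ->
  forall s, P s.
Proof.
move=> P0 P1 P2 s; suff [] : P s /\ forall x, P (x :: s) by [].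
by elim: s => [|x s [IH1 IH2]]; split => // y; apply: P2.
Qed.

Lemma dyck_rpath s : dyck (rpath s).
Proof.
elim: s => // k s IH; rewrite /= -cat1s -[D :: _]cat1s !catA dyck_cat ?dyck_ud //.
exact: dyck_UD.
Qed.

Lemma nseq_cons (T : Type) (b : T) j x : nseq j b ++ b :: x = b :: nseq j b ++ x.
Proof. by elim: j => //= j ->. Qed.

Lemma rpath_ones i v : rpath (nseq i 1 ++ v) = nseq i U ++ rpath v ++ nseq i D.
Proof.
elim: i v => [|i IH] v; first by rewrite /= cats0.
have e : nseq i D ++ [:: D] = D :: nseq i D by rewrite -(nseqD i 1) addn1.
by rewrite /= IH -[ud 0]/[::] -!catA e.
Qed.

Lemma rpath_nseq i : rpath (nseq i 1) = nseq i U ++ nseq i D.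
Proof. by have := rpath_ones i [::]; rewrite cats0. Qed.

Lemma ud_cat i j : ud (i + j) = ud i ++ ud j.
Proof. by rewrite /ud nseqD flatten_cat. Qed.

Lemma dyckF_ud i : dyckF (ud i) = ud i.
Proof. by elim: i => // i IH; rewrite /ud /= (@dyckF_prim_cat [:: U; D]) ?IH. Qed.

Lemma suffix_DD R : dyck R -> R != [::] -> suffix [:: D; D] (U :: R ++ [:: D]).
Proof.
case/lastP: R => // R [] dR _; last first.
  by apply/suffixP; exists (U :: R); rewrite -cats1 -catA.
move: dR; rewrite /dyck => /andP[/eqP dR /allP/(_ (size R))].
rewrite mem_iota size_rcons -cats1 take_size_cat // add0n => /(_ (leqnSn _)).
by move: dR; rewrite -cats1 !count_cat /=; lia.
Qed.

Lemma rpath_eq0 s : (rpath s == [::]) = (s == [::]).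
Proof. by case: s. Qed.

Lemma rF_head s : head 0 (rF s) = head 0 s /\ (rF s == [::]) = (s == [::]).
Proof. by case: s => [|k [|k' [|k'' s]]]. Qed.

Lemma dyckF_cons k s :
  dyckF (rpath (k :: s)) = dyckF (U :: rpath s ++ [:: D]) ++ ud k.-1.
Proof.
have -> : rpath (k :: s) = (U :: rpath s ++ [:: D]) ++ ud k.-1.
  by rewrite /= -catA.
by rewrite dyckF_prim_cat ?prim_UD ?dyck_rpath // dyckF_ud.
Qed.

Lemma dyckF_rpath s : all (fun a => 0 < a) s -> dyckF (rpath s) = rpath (rF s).
Proof.
elim/seq2_ind: s => [//|k _|k k' s IH /= /and3P[k0 k'0 ps]].
  by rewrite dyckF_cons.
have E : U :: rpath (k' :: s) ++ [:: D] =
    U :: (U :: rpath s ++ [:: D]) ++ ud k'.-1 ++ [:: D].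
  by rewrite /= -!catA.
rewrite -[dyckF _]/(dyckF (rpath [:: k, k' & s])) dyckF_cons E.
case: s IH ps E => [|k'' s] IH ps _.
  have -> : U :: (U :: rpath [::] ++ [:: D]) ++ ud k'.-1 ++ [:: D]
     = U :: [::] ++ ud k' ++ [:: D] by case: k' k'0.
  rewrite dyckF_prim_nonprim //= rpath_nseq -!catA.
  by rewrite nseq_cons.
set s2 := k'' :: s in IH ps *.
rewrite dyckF_prim_prim ?dyck_rpath ?suffix_DD ?rpath_eq0 ?dyck_rpath //.
rewrite IH //; have [] := rF_head s2.
case: (rF s2) => // m t /= hm _; rewrite rpath_ones /=.
have m0 : 0 < m by move: ps; rewrite hm /= => /andP[].
have -> : ud m = ud m.-1 ++ ud 1 by rewrite -ud_cat addn1 prednK.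
by rewrite -?catA /= -?catA /= -?catA /= !nseq_cons.
Qed.

Definition downs_from g (w : word) j :=
  count (fun p => p == (D, j)) (zip w (heights g w)).

Lemma heights_cat h g u v : dk h u ->
  heights (h + g) (u ++ v) = heights (h + g) u ++ heights g v.
Proof.
elim: u h => [|[] u IH] h /=; first by move/eqP->.
  by move=> /IH <-.
by case: h => // h /IH <-.
Qed.

Lemma size_heights g w : size (heights g w) = size w.
Proof. by elim: w g => //= a w IH g; rewrite IH. Qed.

Lemma downs_cat g u v j : dyck u ->
  downs_from g (u ++ v) j = downs_from g u j + downs_from g v j.
Proof.
rewrite dyckE /downs_from => /(@heights_cat 0 g u v) ->.
by rewrite zip_cat ?size_heights // count_cat.
Qed.

Lemma downs_ud g k j : downs_from g (ud k) j = (g == j) * k.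
Proof.
elim: k => [|k IH]; first by rewrite muln0.
rewrite -[ud _]/([:: U; D] ++ ud k) downs_cat // IH mulnS.
by rewrite /downs_from /= !xpair_eqE /= add0n addn0.
Qed.

Lemma downs_rpath g s j : all (fun a => 0 < a) s ->
  downs_from g (rpath s) j = if j < g then 0 else nth 0 s (j - g).
Proof.
elim: s g => [|k s IH] g /=; first by rewrite nth_nil; case: ifP.
case/andP=> k0 /IH {}IH.
have -> : downs_from g (U :: rpath s ++ D :: ud k.-1) j =
   downs_from g.+1 (rpath s ++ D :: ud k.-1) j by [].
rewrite downs_cat ?dyck_rpath // IH.
have -> : downs_from g.+1 (D :: ud k.-1) j = (g == j) + downs_from g (ud k.-1) j.
  by rewrite {1}/downs_from /= xpair_eqE.
rewrite downs_ud ltnS; case: (ltngtP j g) => [||->] //=.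
  by case E: (j - g) => [|d] gj /=; [lia|rewrite !addn0; congr nth; lia].
by rewrite subnn /=; lia.
Qed.

Lemma bigmax_heights_ud g k : \max_(x <- heights g (ud k)) x <= g.+1.
Proof.
elim: k => [|k IH]; first by rewrite big_nil.
by rewrite /= !big_cons !geq_max leqnn leqnSn IH.
Qed.

Lemma bigmax_heights_rpath g s :
  \max_(x <- heights g (rpath s)) x = if s is [::] then 0 else g + size s.
Proof.
elim: s g => [|k s IH] g; first by rewrite big_nil.
rewrite /= (@heights_cat 0 g.+1) -?dyckE ?dyck_rpath // big_cons big_cat /= IH.
rewrite big_cons; have := bigmax_heights_ud g k.-1.
by case: (s) => [|? ?] /=; lia.
Qed.

Lemma comp_rpath s : all (fun a => 0 < a) s -> comp_of_path (rpath s) = rev s.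
Proof.
move=> ps; rewrite /comp_of_path.
have -> : height (rpath s) = size s by rewrite /height bigmax_heights_rpath; case: (s).
apply: (@eq_from_nth _ 0); first by rewrite size_map size_iota size_rev.
move=> i; rewrite size_map size_iota => si.
rewrite (nth_map 0) ?size_iota // nth_iota // nth_rev //.
by rewrite -[downs_to _ _]/(downs_from 0 _ _) downs_rpath // subn0 add1n.
Qed.

Lemma path_of_compK c :
  all (fun a => 0 < a) c -> comp_of_path (path_of_comp c) = c.
Proof. by move=> pc; rewrite comp_rpath ?all_rev // revK. Qed.

Lemma path_size_rpath s : all (fun a => 0 < a) s -> path_size (rpath s) = sumn s.
Proof.
elim: s => //= k s IH /andP[k0 /IH <-]; rewrite /path_size /= count_cat /=.
have -> : count_mem U (ud k.-1) = k.-1 by elim: (k.-1) => //= j ->.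
by lia.
Qed.

Lemma dk_split h w : dk h.+1 w ->
  exists a b, [/\ w = a ++ D :: b, dyck a & dk h b].
Proof.
elim: {w}(size w) {-2}w (leqnn (size w)) h => [|m IH] [|[] w] //= wm h dw.
  have [a [b [e da db]]] := IH w wm _ dw.
  have bm : size b <= m by move: wm; rewrite e size_cat /=; lia.
  have [a' [b' [e' da' db']]] := IH b bm _ db.
  exists (U :: (a ++ [:: D]) ++ a'), b'; split=> //.
    by rewrite e e' /= -!catA.
  by rewrite -cat_cons dyck_cat // dyck_UD.
by exists [::], w.
Qed.

Lemma dyck_split w : dyck w -> w != [::] ->
  exists a b, [/\ w = U :: a ++ D :: b, dyck a & dyck b].
Proof.
rewrite dyckE; case: w => [|[] w] //= /dk_split[a [b [-> da db]]] _.
by exists a, b; rewrite [dyck b]dyckE.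
Qed.

Lemma avoids_catl u v : avoids_DUU (u ++ v) -> avoids_DUU u.
Proof. by apply: contraNN => /infix_catr. Qed.

Lemma avoids_catr u v : avoids_DUU (u ++ v) -> avoids_DUU v.
Proof. by apply: contraNN => /infix_catl. Qed.

Lemma avoids_ud b : dyck b -> avoids_DUU (D :: b) -> exists i, b = ud i.
Proof.
elim: {b}(size b) {-2}b (leqnn (size b)) => [|m IH] [|x b] // bm db ab.
- by exists 0.
- by exists 0.
have [a [c [e da dc]]] := dyck_split db isT.
case: (eqVneq a [::]) => [a0|a0]; last first.
  have [a1 [a2 [ea _ _]]] := dyck_split da a0.
  by move: ab; rewrite /avoids_DUU e ea /= prefix0s.
rewrite e a0 in ab bm *.
have [||i ->] := IH c _ dc; last by exists i.+1.
  by move: bm => /=; lia.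
exact: (@avoids_catr [:: D; U]).
Qed.

Lemma dyck_avoids_rpath w : dyck w -> avoids_DUU w ->
  exists2 s, all (fun a => 0 < a) s & w = rpath s.
Proof.
elim: {w}(size w) {-2}w (leqnn (size w)) => [|m IH] [|x w] // wm dw aw.
- by exists [::].
- by exists [::].
have [a [b [e da db]]] := dyck_split dw isT; rewrite e in aw wm *.
have [i eb] : exists i, b = ud i.
  by apply: avoids_ud => //; apply: (@avoids_catr (U :: a)).
have [||s ps ea] := IH a _ da.
- by move: wm; rewrite /= size_cat; lia.
- exact/(@avoids_catl _ (D :: b))/(@avoids_catr [:: U]).
by exists (i.+1 :: s) => //=; rewrite ea eb.
Qed.

Lemma avoids_rpath s : avoids_DUU (rpath s).
Proof.
have ad i : avoids_DUU (D :: ud i) by elim: i => [|[|i] IH].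
elim: s => // k s IH.
suff : avoids_DUU (rpath s ++ D :: ud k.-1) by [].
elim: (rpath s) IH => [|x u IHu]; first by move=> _; apply: ad.
rewrite /avoids_DUU cat_cons !infix_consl !negb_or.
case/andP=> pu /IHu; rewrite /avoids_DUU => ->; rewrite andbT.
by case: x u pu {IHu} => [|] [|[|] [|[|] u]] //=; rewrite !prefix0s.
Qed.

Lemma primitive_rpath s : all (fun a => 0 < a) s ->
  primitive (rpath s) = (head 0 s == 1).
Proof.
case: s => [//|k s] /= /andP[k0 ps].
have e : U :: rpath s ++ D :: ud k.-1 = (U :: rpath s ++ [:: D]) ++ ud k.-1.
  by rewrite /= -catA.
case: k k0 e => // -[|k] _ e; first by rewrite e cats0 prim_UD ?dyck_rpath.
rewrite e; set q := U :: _; have dq : dyck q := dyck_UD (dyck_rpath s).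
apply: contraTF dq => /and3P[_ _ /allP/(_ (size q))].
by rewrite take_size_cat // mem_iota size_cat /=; apply; lia.
Qed.

Lemma rFE k k' s : s != [::] -> rF [:: k, k' & s] =
  k :: nseq k'.-1 1 ++ (head 0 (rF s)).+1 :: behead (rF s).
Proof. by case: s. Qed.

Lemma rF_pos s : all (fun a => 0 < a) s -> all (fun a => 0 < a) (rF s).
Proof.
elim/seq2_ind: s => // k k' s IH /and3P[k0 k'0 /IH {}IH].
have ones j : all (fun a => 0 < a) (nseq j 1) by rewrite all_nseq orbT.
case: (eqVneq s [::]) => [->|s0]; first by rewrite /= k0 ones.
rewrite rFE //= k0 all_cat ones /=.
by case: (rF s) IH => //= m t /andP[].
Qed.

Lemma sumn_rF s : all (fun a => 0 < a) s -> sumn (rF s) = sumn s.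
Proof.
elim/seq2_ind: s => // k k' s IH /and3P[k0 k'0 /IH {}IH].
case: (eqVneq s [::]) => [->|s0]; first by rewrite /= sumn_nseq; lia.
rewrite rFE //= sumn_cat sumn_nseq -IH.
have [_] := rF_head s; rewrite (negbTE s0).
by case: (rF s) => //= m t _; lia.
Qed.

Lemma rF_inj s t : all (fun a => 0 < a) s -> all (fun a => 0 < a) t ->
  rF s = rF t -> s = t.
Proof.
have nones i j m u : 0 < m -> nseq i 1 <> nseq j 1 ++ m.+1 :: u.
  by move=> m0; elim: j i => [|j IH] [|i] //=; [case: m m0 | case; apply: IH].
have ones2 i j m m' u u' : 0 < m -> 0 < m' ->
    nseq i 1 ++ m.+1 :: u = nseq j 1 ++ m'.+1 :: u' -> i = j /\ m :: u = m' :: u'.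
  move=> m0 m'0; elim: i j => [|i IH] [|j] /=.
  - by case=> -> ->.
  - by case=> m1; move: m0; rewrite m1.
  - by case=> m1; move: m'0; rewrite -m1.
  - by case=> /IH[-> ->].
have rFc r : all (fun a => 0 < a) r -> r != [::] ->
    exists m u, rF r = m :: u /\ 0 < m.
  move=> /rF_pos + r0; have [_] := rF_head r; rewrite (negbTE r0).
  by case: (rF r) => // m u _ /andP[m0 _]; exists m, u.
have ones1 r : rF [:: r] = [:: r] by [].
elim/seq2_ind: s t => [|k|k k' s IH] t.
- by move=> _ _ e; apply/esym/eqP; have [_ <-] := rF_head t; rewrite -e.
- case: t => [|l [|l' t]] // _ /and3P[_ l0 _].
  case: (eqVneq t [::]) => [->|t0]; first by case: l' l0.
  by rewrite rFE //; case: (l'.-1).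
case: t => [|l [|l' t]].
- by move=> _ _ e; apply/eqP; have [_ <-] := rF_head [:: k, k' & s]; rewrite e.
- move=> /and3P[_ k0 _] _.
  case: (eqVneq s [::]) => [->|s0]; first by case: k' k0.
  by rewrite rFE //; case: (k'.-1).
move=> /and3P[k0 k'0 ps] /and3P[l0 l'0 pt].
case: (eqVneq s [::]) => [s0|s0]; case: (eqVneq t [::]) => [t0|t0].
- by rewrite s0 t0 => -[-> /(congr1 size)]; rewrite !size_nseq => ->.
- have [m [u [e m0]]] := rFc _ pt t0.
  by rewrite s0 [in RHS]rFE // e => -[_ /nones-/(_ m0)].
- have [m [u [e m0]]] := rFc _ ps s0.
  by rewrite t0 [in LHS]rFE // e => -[_ /esym/nones-/(_ m0)].
have [m [u [e m0]]] := rFc _ ps s0; have [m' [u' [e' m'0]]] := rFc _ pt t0.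
rewrite !rFE // e e' /= => -[-> /ones2-/(_ m0 m'0)[kl]].
rewrite -e -e' => /IH -> //.
by rewrite -(prednK k'0) kl prednK.
Qed.

Definition compF_seq (c : seq nat) : seq nat :=
  comp_of_path (dyckF (path_of_comp c)).

Lemma compF_seqE c : all (fun a => 0 < a) c -> compF_seq c = rev (rF (rev c)).
Proof.
move=> pc; rewrite /compF_seq /path_of_comp dyckF_rpath ?all_rev //.
by rewrite comp_rpath // rF_pos ?all_rev.
Qed.

Lemma last_head_rev (c : seq nat) : last 0 c = head 0 (rev c).
Proof. by case/lastP: c => // c x; rewrite last_rcons rev_rcons. Qed.

Lemma compF_subproof n (c : comp1 n) :
  is_composition n (compF_seq c) && (last 0 (compF_seq c) == 1).
Proof.
case: c => c /= /andP[/andP[pc /eqP sc] lc]; rewrite compF_seqE //.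
rewrite /is_composition all_rev rF_pos ?all_rev // sumn_rev sumn_rF ?all_rev //.
rewrite sumn_rev sc eqxx last_head_rev revK.
by have [-> _] := rF_head (rev c); rewrite -last_head_rev.
Qed.

Definition compF_fun n (c : comp1 n) : comp1 n := Comp1 (compF_subproof c).

Lemma compF_inj n : injective (@compF_fun n).
Proof.
move=> c d /(congr1 val) /=; case: c d => [c pc] [d pd] /= e; apply: val_inj => /=.
case/andP: pc pd e => /andP[pc _] _ /andP[/andP[pd _] _].
rewrite !compF_seqE // => /(can_inj revK) /rF_inj.
by rewrite !all_rev => /(_ pc pd) /(can_inj revK).
Qed.

(* The permutation of the compositions of [n] with last entry 1 induced by
   [dyckF]; see [compF_of_path]. *)
Definition compF n : {perm comp1 n} := perm (@compF_inj n).

Lemma comp1_of_path n w : dyck w -> avoids_DUU w -> primitive w -> path_size w = n ->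
  is_composition n (comp_of_path w) && (last 0 (comp_of_path w) == 1).
Proof.
move=> /dyck_avoids_rpath/[apply]-[s ps ->].
rewrite primitive_rpath // path_size_rpath // comp_rpath // => hs <-.
by rewrite /is_composition all_rev ps sumn_rev eqxx last_head_rev revK.
Qed.

Lemma compF_of_path n (c : comp1 n) w :
  dyck w -> avoids_DUU w -> comp_of_path w = c ->
  comp_of_path (dyckF w) = compF n c.
Proof.
move=> /dyck_avoids_rpath/[apply]-[s ps ->]; rewrite permE /= comp_rpath // => <-.
by rewrite /compF_seq /path_of_comp revK.
Qed.

Lemma comp1_path n (c : comp1 n) :
  [/\ dyck (path_of_comp c), avoids_DUU (path_of_comp c),
      primitive (path_of_comp c) & path_size (path_of_comp c) = n].
Proof.
case: c => c /= /andP[/andP[pc /eqP sc] lc].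
rewrite /path_of_comp dyck_rpath avoids_rpath primitive_rpath ?all_rev //.
by rewrite -last_head_rev path_size_rpath ?all_rev // sumn_rev.
Qed.

Lemma dyckF_avoids w : dyck w -> avoids_DUU w -> dyck (dyckF w) && avoids_DUU (dyckF w).
Proof.
move=> /dyck_avoids_rpath/[apply]-[s ps ->].
by rewrite dyckF_rpath // dyck_rpath avoids_rpath.
Qed.

Definition comp_parity (c : seq nat) : nat := odd (size c).

Definition orbit_parity n (X : {set comp1 n}) : nat :=
  (\sum_(c in X) comp_parity c) %% 2.

Definition binary_digits (m : nat) : nat :=
  if m == 0 then 0 else (trunc_log 2 m).+1.

Lemma binary_digitsP m : 0 < m ->
  2 ^ (binary_digits m).-1 <= m < 2 ^ binary_digits m.
Proof. by rewrite /binary_digits; case: m => // m _; apply: trunc_log_bounds. Qed.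

(* Main.v *)
(* Record a composition of [n] ending with 1, read backwards, by the parities
   [x_p] of the number of its partial sums that are at most [p], for [p < n].
   In these coordinates the inverse of [F] is the difference operator
   [x_p + x_(p-1)] over the field with two elements. Its [2^m]-th power is
   [x_p + x_(p-2^m)], and the sum of its powers with exponents below [2^m] is
   [x_(p-2^m+1)]. As [x_0 = 0] and [x_1 = 1], every orbit has length the least
   [2^m >= n-1]. The number of parts has the parity of [1 + x_(n-1)], so the
   parity of an orbit is that of [2^m + x_(n-2^m)]. *)
Require Import Defs.
From mathcomp Require Import all_boot all_fingroup cyclic zify.

Set Implicit Arguments.
Unset Strict Implicit.
Unset Printing Implicit Defensive.

(** * Powers of the difference operator modulo 2 *)

Definition diff (f : nat -> bool) (p : nat) : bool := f p (+) f p.-1.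

(** With [S] the shift [p -> p.-1], [diff] is [1 + S], and squaring is additive in characteristic 2.
    Truncation at 0 is harmless, since truncated shifts still compose by adding their lengths. *)
Lemma iter_diff_pow2 m f p : iter (2 ^ m) diff f p = f p (+) f (p - 2 ^ m).
Proof.
elim: m f p => [|m IH] f p; first by rewrite expn0 /= /diff subn1.
rewrite expnS mul2n -addnn iterD !IH subnDA.
by rewrite addbA addbK.
Qed.

(** By doubling: the second half of the sum is the first half applied to [iter (2 ^ m) diff f], and
    modulo 2 the terms without the extra shift by [2 ^ m] cancel. *)
Lemma sum_iter_diff_pow2 m f p :
  \big[addb/false]_(k < 2 ^ m) iter k diff f p = f (p - (2 ^ m).-1).
Proof.
elim: m f p => [|m IH] f p; first by rewrite expn0 big_ord1 subn0.
rewrite expnS mul2n -addnn big_split_ord /= IH.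
under eq_bigr => k _ do rewrite addnC iterD.
rewrite IH iter_diff_pow2 addbA addbb /= -subnDA; congr f.
by have := expn_gt0 2 m; lia.
Qed.

(** * Coordinates of a composition: partial sums counted modulo 2 *)

Fixpoint cut_parity (s : seq nat) (p : nat) : bool :=
  if s is k :: s' then (k <= p) && ~~ cut_parity s' (p - k) else false.

Lemma cut_parity0 s : all (fun a => 0 < a) s -> cut_parity s 0 = false.
Proof. by case: s => [|[]]. Qed.

Lemma cut_parity_ones j s q : all (fun a => 0 < a) s ->
  cut_parity (nseq j 1 ++ s) q = odd (minn q j) (+) cut_parity s (q - j).
Proof.
move=> ps; elim: j q => [|j IH] q; first by rewrite minn0 subn0.
case: q => [|q]; first by rewrite /= cut_parity0.
by rewrite /= subn1 /= IH subSS minnSS /= addNb.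
Qed.

Lemma cut_parity_succ_head h s q :
  cut_parity (h.+1 :: s) q = (0 < q) && cut_parity (h :: s) q.-1.
Proof. by case: q. Qed.

(** Only the total exceeds [(sumn s).-1], so all partial sums but one are counted. *)
Lemma cut_parity_pred s : all (fun a => 0 < a) s -> s != [::] ->
  cut_parity s (sumn s).-1 = ~~ odd (size s).
Proof.
elim: s => //= k s IH /andP[k0 ps] _; case: (eqVneq s [::]) => [->|s0] /=.
  by rewrite addn0; lia.
have s1 : 0 < sumn s by move: ps s0; case: (s) => //= a t /andP[]; lia.
have -> : (k + sumn s).-1 - k = (sumn s).-1 by lia.
by rewrite IH // (_ : k <= _) //; lia.
Qed.

(** The first entry is the least [p] of odd count; removing it shifts and negates the remaining
    values. *)
Lemma cut_parity_inj n s t :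
  all (fun a => 0 < a) s -> all (fun a => 0 < a) t ->
  sumn s = n -> sumn t = n ->
  (forall p, p < n -> cut_parity s p = cut_parity t p) -> s = t.
Proof.
elim: s t n => [|k s IH] [|l t] n //=.
- by move=> _ /andP[l0 _] <-; lia.
- by move=> /andP[k0 _] _ <-; lia.
move=> /andP[k0 ps] /andP[l0 pt] sk sl e.
have kl : k = l.
  have [kl|lk|//] := ltngtP k l.
    have := e k; rewrite leqnn subnn cut_parity0 //=.
    by rewrite (ltn_geF kl) => /(_ ltac:(lia)).
  have := e l; rewrite leqnn subnn (cut_parity0 pt) /=.
  by rewrite (ltn_geF lk) => /(_ ltac:(lia)).
rewrite -kl in sl e *; congr (_ :: _).
apply: (IH _ (sumn s)) => // [|p ps']; first lia.
have := e (k + p) ltac:(lia); rewrite leq_addr addKn /=; exact: negb_inj.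
Qed.

(** The left side tests whether [p] is a partial sum of [rF s]. Below [sumn s] these are the [p] of
    odd count in [s]: the entries [k, k'] yield the sums from [k] to [k + k' - 1], and the rest are
    those of the recursive call moved by [k + k']. *)
Lemma cut_parity_rF s p : all (fun a => 0 < a) s -> p < sumn s ->
  diff (cut_parity (rF s)) p = cut_parity s p.
Proof.
rewrite /diff; elim/seq2_ind: s p => [//|k|k k' s IH] p.
  by move=> _ /=; lia.
move=> /= /and3P[k0 k'0 ps] pn; rewrite -/(rF [:: k, k' & s]).
(* For empty [s] the total [k + k'] is a partial sum too, hence [k'] ones instead of [k'.-1]. *)
have E q : cut_parity (rF [:: k, k' & s]) q =
    (k <= q) && ~~ (odd (minn (q - k) (if s is [::] then k' else k'.-1))
                    (+) cut_parity (rF s) (q - k - k')).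
  case: s ps {IH pn} => [|k'' s] ps.
    by rewrite /= -[nseq k' 1]cats0 cut_parity_ones.
  set s2 := _ :: s in ps *.
  have := rF_pos ps; have [_] := rF_head s2; rewrite rFE //.
  case: (rF s2) => // h u _ pu.
  rewrite [LHS]/= cut_parity_ones /=; last by case/andP: pu.
  congr (_ && ~~ (_ (+) _)); rewrite -[LHS]/(cut_parity (h.+1 :: u) _).
  rewrite cut_parity_succ_head -[RHS]/(cut_parity (h :: u) _).
  have -> : (q - k - k'.-1).-1 = q - k - k' by lia.
  case: posnP => // q0; rewrite (_ : q - k - k' = 0) ?cut_parity0 //; lia.
rewrite !E {E} /=.
have [pk|kp|->] := ltngtP p k; first by rewrite (_ : k <= p.-1 = false) //; lia.
  rewrite (_ : k <= p.-1) /=; last lia.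
  have -> : p.-1 - k - k' = (p - k - k').-1 by lia.
  rewrite addbN addNb negbK addbACA.
  have [k'q|qk'] := leqP k' (p - k).
    have s0 : s != [::] by apply: contraTneq pn => -> /=; lia.
    rewrite IH //; last lia.
    rewrite negbK -[RHS]addFb; congr (_ (+) _).
    by case: (s) s0 => // a t _; rewrite !(minn_idPr _) ?addbb //; lia.
  (* Here [k < p < k + k']: exactly one more 1 has been passed than at [p.-1], so the parity
     flips. *)
  have -> : p - k - k' = 0 by lia.
  rewrite cut_parity0 ?rF_pos // addbF.
  by rewrite !(minn_idPl _); case: (s); lia.
rewrite subnn min0n sub0n !cut_parity0 ?rF_pos //.
by rewrite (_ : k <= k.-1 = false) 1?(_ : k' <= 0 = false) //; lia.
Qed.

(** * The inverse permutation in these coordinates *)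

Lemma comp1_rev n (c : comp1 n) :
  [/\ all (fun a => 0 < a) (rev c), sumn (rev c) = n & head 0 (rev c) = 1].
Proof.
case: c => c /= /andP[/andP[pc /eqP sc] /eqP lc].
by rewrite all_rev sumn_rev -last_head_rev.
Qed.

Lemma rev_compF n (c : comp1 n) : rev (compF n c) = rF (rev c).
Proof.
have [pc _ _] := comp1_rev c; rewrite all_rev in pc.
by rewrite permE /= compF_seqE // revK.
Qed.

Lemma cut_parity_iterV n k (c : comp1 n) p : p < n ->
  cut_parity (rev (iter k (compF n)^-1%g c)) p
  = iter k diff (cut_parity (rev c)) p.
Proof.
elim: k p => [//|k IH] p pn; rewrite !iterS.
set d := iter k _ c in IH *.
have dF : d = compF n ((compF n)^-1%g d) by rewrite permKV.
have [pd sd _] := comp1_rev ((compF n)^-1%g d).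
rewrite -cut_parity_rF ?sd // -rev_compF -dF /diff !IH //.
by apply: leq_ltn_trans pn; apply: leq_pred.
Qed.

Lemma cut_parity_comp1 n (c : comp1 n) p :
  p <= 1 -> p < n -> cut_parity (rev c) p = (p == 1).
Proof.
have [pc sc hc] := comp1_rev c; case: p => [|[|]] // _ n1; first exact: cut_parity0.
move: hc pc; case: (rev c) sc => [|k s] //= _ -> /andP[_ ps].
by rewrite subnn cut_parity0.
Qed.

Lemma comp_parityE n (c : comp1 n) :
  0 < n -> comp_parity c = ~~ cut_parity (rev c) n.-1.
Proof.
move=> n0; have [pc sc hc] := comp1_rev c.
rewrite -[in n.-1]sc cut_parity_pred ?negbK ?size_rev //.
by case: (rev c) hc.
Qed.

Lemma iterV_compF_pow2 n (c : comp1 n) m : 0 < n ->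
  (iter (2 ^ m) (compF n)^-1%g c == c) = (n <= (2 ^ m).+1).
Proof.
move=> n0; have n1 : 2 ^ m + 1 - 2 ^ m = 1 by rewrite addKn.
have [pc sc _] := comp1_rev c; apply/eqP/idP => [e|nm].
  rewrite leqNgt; apply/negP => mn.
  (* The coordinate at [2 ^ m + 1] changes by [x_1 = 1]. *)
  have := @cut_parity_iterV n (2 ^ m) c (2 ^ m + 1); rewrite e iter_diff_pow2.
  rewrite n1 (cut_parity_comp1 c (leqnn 1)); last lia.
  by rewrite addn1 mn => /(_ isT); case: cut_parity.
apply: val_inj; apply: (can_inj revK).
have [pd sd _] := comp1_rev (iter (2 ^ m) (compF n)^-1%g c).
apply: (@cut_parity_inj n) => // p pn.
(* Since [p <= 2 ^ m], the added coordinate is [x_0 = 0]. *)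
rewrite cut_parity_iterV // iter_diff_pow2 (_ : p - 2 ^ m = 0); last lia.
by rewrite cut_parity0 // addbF.
Qed.

(** * Lengths and parities of the orbits *)

Lemma ltn_pow2_binary_digits m j : (m < 2 ^ j) = (binary_digits m <= j).
Proof.
case: (posnP m) => [->|m0]; first by rewrite expn_gt0.
have /andP[lo hi] := binary_digitsP m0.
have d0 : 0 < binary_digits m by move: m0; case: (m).
apply/idP/idP => [mj|dj]; last by apply: (leq_trans hi); rewrite leq_exp2l.
by have := leq_ltn_trans lo mj; rewrite ltn_exp2l //; lia.
Qed.

(** The [2 ^ m]-th power is the identity, so the length is some [2 ^ j] with [j <= m]; as [2 ^ j]
    steps fix [c], also [m <= j]. *)
Lemma card_porbitV_compF n (c : comp1 n) : 0 < n ->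
  #|porbit (compF n)^-1%g c| = 2 ^ binary_digits (n - 2).
Proof.
set s := (compF n)^-1%g; set m := binary_digits _ => n0.
have small j : (n <= (2 ^ j).+1) = (m <= j).
  by rewrite -ltn_pow2_binary_digits; have := expn_gt0 2 j; lia.
have : #|porbit s c| %| 2 ^ m.
  rewrite porbitE; apply: dvdn_trans (dvdn_orbit 'P <[s]>%G c) _.
  rewrite -orderE order_dvdn.
  apply/eqP/permP => x; rewrite permX perm1.
  by apply/eqP; rewrite iterV_compF_pow2 ?small.
case/(dvdn_pfactor _ _ (isT : prime 2)) => j jm e; rewrite e; congr (2 ^ _).
have := iter_porbit s c; rewrite e => /eqP.
by rewrite iterV_compF_pow2 // small => mj; apply/eqP; rewrite eqn_leq jm.
Qed.

Lemma big_porbit (T : finType) (s : {perm T}) (x : T) (f : T -> nat) :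
  \sum_(y in porbit s x) f y = \sum_(k < #|porbit s x|) f (iter k s x).
Proof.
rewrite (eq_bigl (mem (traject s x #|porbit s x|))); last first.
  by move=> y; rewrite porbit_traject.
rewrite -big_uniq ?uniq_traject_porbit //=.
rewrite (big_nth x) size_traject big_mkord; apply: eq_bigr => k _.
by rewrite nth_traject.
Qed.

Lemma orbit_parity_porbitV n (c : comp1 n) (m := binary_digits (n - 2)) : 0 < n ->
  orbit_parity (porbit (compF n)^-1%g c) = (m == 0) (+) (n == 2 ^ m + 1).
Proof.
move=> n0; rewrite /orbit_parity modn2; congr nat_of_bool.
rewrite big_porbit card_porbitV_compF // -/m.
rewrite (big_morph odd oddD (erefl : odd 0 = false)).
have step (k : 'I_(2 ^ m)) : true ->
    odd (comp_parity (iter k (compF n)^-1%g c))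
    = true (+) iter k diff (cut_parity (rev c)) n.-1.
  by rewrite comp_parityE // oddb cut_parity_iterV ?ltn_predL.
rewrite (eq_bigr _ step) big_split /= sum_iter_diff_pow2; congr (_ (+) _).
  rewrite big_const_ord; have -> k : iter k negb false = odd k by elim: k => //= k ->.
  by rewrite oddX orbF.
(* This puts the remaining index [n.-1 - (2 ^ m).-1] at 0 or 1, where the coordinate is the same for
   every composition. *)
have : n - 2 < 2 ^ m by rewrite ltn_pow2_binary_digits.
have := expn_gt0 2 m => /= m0 nm.
by rewrite cut_parity_comp1; lia.
Qed.

Lemma parity_condition n (m := binary_digits (n - 2)) : 0 < n ->
  (n = 1 \/ exists j, 1 <= j /\ n = 2 ^ j + 1) <->
  (m == 0) (+) (n == 2 ^ m + 1).
Proof.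
move=> n0; rewrite {}/m; case: (leqP n 2) => n2.
  (* Here [m = 0]. The value [n = 2] is [2 ^ 0 + 1], excluded by [1 <= j], and there the two terms
     on the right cancel. *)
  have -> : n - 2 = 0 by lia.
  rewrite /= expn0; split=> [|n1]; last by left; lia.
  case=> [->//|[[|j] [// _]]]; have := expn_gt0 2 j; rewrite expnS; lia.
have m0 : binary_digits (n - 2) != 0.
  by rewrite -lt0n ltnNge -ltn_pow2_binary_digits; lia.
rewrite (negbTE m0) /=; split=> [|/eqP nm]; last first.
  by right; exists (binary_digits (n - 2)); rewrite lt0n.
case=> [|[j [j1 nj]]]; first lia.
(* Indeed [n - 2 = 2 ^ j - 1] has exactly [j] binary digits. *)
suff -> : binary_digits (n - 2) = j by apply/eqP.
apply/eqP; rewrite eqn_leq -ltn_pow2_binary_digits; apply/andP; split.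
  by have := expn_gt0 2 j; lia.
rewrite leqNgt; apply/negP => mj.
have : n - 2 < 2 ^ j.-1 by rewrite ltn_pow2_binary_digits; lia.
by have := expn_gt0 2 j.-1; rewrite nj -(prednK j1) expnS /=; lia.
Qed.

Theorem theorem6 (n : nat) (hn : 1 <= n) :
  [/\ (exists L : nat,
         (forall X : {set comp1 n}, X \in porbits (compF n) -> #|X| = L)
         /\ (exists m : nat, L = 2 ^ m)),
      (exists e : nat,
         forall X : {set comp1 n}, X \in porbits (compF n) ->
           orbit_parity X = e)
    & forall X : {set comp1 n}, X \in porbits (compF n) ->
        [/\ n = 1 -> #|X| = 1,
            2 <= n -> #|X| = 2 ^ binary_digits (n - 2),
            (n = 1 \/ exists j : nat, 1 <= j /\ n = 2 ^ j + 1) ->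
              orbit_parity X = 1
          & ~ (n = 1 \/ exists j : nat, 1 <= j /\ n = 2 ^ j + 1) ->
              orbit_parity X = 0]].
Proof.
pose m := binary_digits (n - 2).
(* A permutation and its inverse have the same orbits. *)
have card X : X \in porbits (compF n) -> #|X| = 2 ^ m.
  by case/imsetP=> c _ ->; rewrite -porbitV card_porbitV_compF.
have par X : X \in porbits (compF n) ->
    orbit_parity X = (m == 0) (+) (n == 2 ^ m + 1).
  by case/imsetP=> c _ ->; rewrite -porbitV orbit_parity_porbitV.
split; [by exists (2 ^ m); split=> //; exists m | by eexists; exact: par |].
move=> X XF; rewrite (card _ XF) (par _ XF); split=> //.
- by rewrite /m => ->.
- by move/(parity_condition hn); rewrite -/m => ->.
- by move/(parity_condition hn)/negP/negbTE; rewrite -/m => ->.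
Qed.
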